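(* Let $(X,\mathcal{B},T)$ be a Borel system and $A\in\mathcal{B}$. Let $\mathrm{div}(A)$ be the ($T$-invariant, measurable) set of points $x\in X$ for which the sequence $\frac1n\sum_{i=0}^{n-1}1_A(T^ix)$, $n=1,2,\dots$, does not converge. Then the restriction of $T$ to $\mathrm{div}(A)$ has a $4$-set generator.
   Context: A Borel system $(X,\mathcal{B},T)$ is a standard Borel space with a Borel automorphism $T$. For an invariant Borel set $Y\subseteq X$, a $k$-set generator of $T|_Y$ is a measurable partition $\{B_1,\dots,B_k\}$ of $Y$ (empty members allowed) such that $\{T^jB_i: j\in\mathbb{Z},1\le i\le k\}$ generates the $\sigma$-algebra $\mathcal{B}|_Y$ of Borel subsets of $Y$. *)

(* Defs.v *)
From HB Require Import structures.
From mathcomp Require Import all_boot all_order all_algebra.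
From mathcomp Require Import all_classical all_reals all_analysis.

Set Implicit Arguments.
Unset Strict Implicit.
Unset Printing Implicit Defensive.

Import Order.TTheory GRing.Theory Num.Theory.
Import numFieldNormedType.Exports.

Local Open Scope classical_set_scope.
Local Open Scope ring_scope.

(* A measurable space is given here by a type [X] and a family
   [B : set (set X)] rather than by a [measurableType], and completeness is
   spelled out rather than taken from [completeType], because both of these
   structures are pointed and would exclude the empty space. *)

Definition polish (R : realType) (P : metricType R) : Prop :=
  (exists2 D : set P, countable D & dense D) /\
  (forall F : set_system P, ProperFilter F -> cauchy F -> exists x : P, F --> x).

(* Isomorphic to a Polish space with its Borel sigma-algebra [<<s open >>]. *)
Definition standard_borel (R : realType) (X : Type) (B : set (set X)) : Prop :=
  exists (P : metricType R) (f : X -> P),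
    [/\ polish P, bijective f &
        B = [set f @^-1` U | U in <<s [set U : set P | open U] >>]].

(* Since [T] is bijective, [T @` E] is the preimage of [E] under its inverse. *)
Definition borel_automorphism (X : Type) (B : set (set X)) (T : X -> X) : Prop :=
  [/\ bijective T,
      forall E, B E -> B (T @^-1` E) &
      forall E, B E -> B (T @` E)].

Definition invariant_set (X : Type) (T : X -> X) (Y : set X) : Prop :=
  T @^-1` Y = Y.

(* [arithmetic_mean u n] averages the [n.+1] terms [u 0], ..., [u n]. *)
Definition div_set (R : realType) (X : Type) (T : X -> X) (A : set X) : set X :=
  [set x | ~ cvgn (arithmetic_mean (fun i : nat => \1_A (iter i T x) : R))].

(* The sets T^j C with j in Z: forward images for j >= 0 and preimages for
   j <= 0. *)
Definition translates (X : Type) (T : X -> X) (C : set X) : set (set X) :=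
  [set iter n T @` C | n in [set: nat]] `|`
  [set iter n T @^-1` C | n in [set: nat]].

(* The members [C i] of the partition may be empty, so this is not the
   library's [partition]. *)
Definition is_set_generator (X : Type) (B : set (set X)) (T : X -> X)
    (Y : set X) (k : nat) (C : 'I_k -> set X) : Prop :=
  [/\ forall i, B (C i),
      trivIset [set: 'I_k] C,
      \bigcup_i C i = Y &
      <<s Y, \bigcup_i translates T (C i) >> = strace B Y].

Definition has_set_generator (X : Type) (B : set (set X)) (T : X -> X)
    (Y : set X) (k : nat) : Prop :=
  exists C : 'I_k -> set X, is_set_generator B T Y C.

(* Main.v *)
(* If the averages of 1_A along x diverge, there are p and q such that the
   number S(n) of visits to A before time n satisfies q S(n) < p n - K for some
   n and q S(n) > (p + 1) n + K for some n, whatever K.  Parenthesis matching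
   along the orbit then gives, equivariantly, injections of p + 1 copies of the
   orbit into q copies of its intersection with A, and of the latter into p
   copies of the orbit.  So p + 1 copies of the orbit embed into p copies;
   iterating, infinitely many copies embed into p copies.  Every point is thus
   given infinitely many cells in p layers, and restricting to a single
   well-chosen layer embeds infinitely many copies of the orbit into the orbit
   itself: x is given addresses T^(a(x,n)) x, all distinct as (x, n) varies,
   with a(x,n) a function of the A-name of x.  Let (E_n) generate the Borel
   sets and let C be the set of the points T^(a(x,n)) x with x in E_n.  Then
   x is in E_n iff T^(a(x,n)) x is in C, so {A, A^c} joined with {C, C^c} is a
   generator. *)

Require Import Defs.
From HB Require Import structures.
From mathcomp Require Import all_boot all_order all_algebra.
From mathcomp Require Import all_classical all_reals all_analysis.
From mathcomp Require Import zify lra.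

Set Implicit Arguments.
Unset Strict Implicit.
Unset Printing Implicit Defensive.

Import Order.TTheory GRing.Theory Num.Theory.
Import numFieldNormedType.Exports.

Local Open Scope classical_set_scope.
Local Open Scope ring_scope.

(** * Borel predicates and Borel functions of names *)

Definition name := int -> bool.

Definition shift (i : int) (w : name) : name := fun j => w (i + j).

Lemma shift0 w : shift 0 w = w.
Proof. by apply/funext => j; rewrite /shift add0r. Qed.

Lemma shiftD i j w : shift i (shift j w) = shift (i + j) w.
Proof. by apply/funext => k; rewrite /shift addrA (addrC j). Qed.

(* The predicates in the sigma-algebra generated by the coordinates, as an
   inductive closure: countable quantifiers then give measurability directly. *)
Inductive borel_pred : (name -> Prop) -> Prop :=
| borel_coord i : borel_pred (fun w => w i)
| borel_not P : borel_pred P -> borel_pred (fun w => ~ P w)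
| borel_ex_nat (P : nat -> name -> Prop) :
    (forall n, borel_pred (P n)) -> borel_pred (fun w => exists n, P n w).

Lemma borel_ext (P Q : name -> Prop) :
  (forall w, P w <-> Q w) -> borel_pred P -> borel_pred Q.
Proof. by move=> PQ; have -> : P = Q by apply/funext => w; apply/propext. Qed.

Lemma borel_or P Q :
  borel_pred P -> borel_pred Q -> borel_pred (fun w => P w \/ Q w).
Proof.
move=> bP bQ; apply: (@borel_ext (fun w => exists n, (if n is 0%N then P else Q) w)).
  move=> w; split=> [[[|n]]|[]]; [by left|by right|by exists 0%N|by exists 1%N].
by apply: borel_ex_nat => -[].
Qed.

Lemma borel_and P Q :
  borel_pred P -> borel_pred Q -> borel_pred (fun w => P w /\ Q w).
Proof.
move=> bP bQ; apply: (@borel_ext (fun w => ~ (~ P w \/ ~ Q w))).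
  by move=> w; rewrite not_orE !notK.
by apply/borel_not/borel_or; exact: borel_not.
Qed.

Lemma borel_const (Q : Prop) : borel_pred (fun=> Q).
Proof.
have bT : borel_pred (fun=> True).
  apply: (@borel_ext (fun w => w 0 \/ ~ w 0)); first by move=> w; split=> // _; exact: EM.
  by apply: borel_or; [|apply: borel_not]; exact: borel_coord.
have [q|nq] := pselect Q; first exact: borel_ext bT.
by apply: borel_ext (borel_not bT) => w; tauto.
Qed.

Lemma borel_ex (T : countType) (P : T -> name -> Prop) :
  (forall t, borel_pred (P t)) -> borel_pred (fun w => exists t, P t w).
Proof.
move=> bP; apply: (@borel_ext (fun w => exists n : nat,
    (if unpickle n is Some t then P t else fun=> False) w)).
  move=> w; split=> [[n]|[t Pt]]; first by case: unpickle => // t; exists t.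
  by exists (pickle t); rewrite pickleK.
by apply: borel_ex_nat => n; case: unpickle => // ; exact: borel_const.
Qed.

Lemma borel_all (T : countType) (P : T -> name -> Prop) :
  (forall t, borel_pred (P t)) -> borel_pred (fun w => forall t, P t w).
Proof.
move=> bP; apply: (@borel_ext (fun w => ~ exists t, ~ P t w)).
  by move=> w; rewrite -forallNE; split=> h t; move: (h t); rewrite notK.
by apply/borel_not/borel_ex => t; exact: borel_not.
Qed.

Lemma borel_imply P Q :
  borel_pred P -> borel_pred Q -> borel_pred (fun w => P w -> Q w).
Proof.
move=> bP bQ; apply: (@borel_ext (fun w => ~ P w \/ Q w)).
  by move=> w; rewrite implyE.
exact: borel_or (borel_not bP) bQ.
Qed.

Lemma borel_shift i P : borel_pred P -> borel_pred (fun w => P (shift i w)).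
Proof.
elim=> [j|{}P _|{}P _]; [exact: borel_coord|exact: borel_not|exact: borel_ex_nat].
Qed.

Definition borel_fun (T : Type) (f : name -> T) := forall t, borel_pred (fun w => f w = t).

Lemma borel_fun_cst (T : Type) (t : T) : borel_fun (fun=> t).
Proof. by move=> u; exact: borel_const. Qed.

(** A level set of the composite is a countable union over the values of [f], so nested choices can
    be checked with one parameter frozen at a time. *)
Lemma borel_fun_bind (T : countType) (U : Type) (f : name -> T) (g : T -> name -> U) :
  borel_fun f -> (forall t, borel_fun (g t)) -> borel_fun (fun w => g (f w) w).
Proof.
move=> bf bg u; apply: (@borel_ext (fun w => exists t, f w = t /\ g t w = u)).
  by move=> w; split=> [[t [->]]|]; last by exists (f w).
by apply: borel_ex => t; apply: borel_and => //; exact: bg.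
Qed.

Lemma borel_pred_bind (T : countType) (f : name -> T) (P : T -> name -> Prop) :
  borel_fun f -> (forall t, borel_pred (P t)) -> borel_pred (fun w => P (f w) w).
Proof.
move=> bf bP; apply: (@borel_ext (fun w => exists t, f w = t /\ P t w)).
  by move=> w; split=> [[t [->]]|]; last by exists (f w).
by apply: borel_ex => t; apply: borel_and => //; exact: bf.
Qed.

Lemma borel_fun_map (T : countType) (U : Type) (h : T -> U) (f : name -> T) :
  borel_fun f -> borel_fun (fun w => h (f w)).
Proof.
move=> bf; apply: (borel_fun_bind (g := fun t _ => h t)) bf _ => t.
exact: borel_fun_cst.
Qed.

Lemma borel_fun_map2 (T1 T2 : countType) (U : Type) (h : T1 -> T2 -> U)
    (f1 : name -> T1) (f2 : name -> T2) :
  borel_fun f1 -> borel_fun f2 -> borel_fun (fun w => h (f1 w) (f2 w)).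
Proof.
move=> b1 b2; apply: (borel_fun_bind (g := fun t w => h t (f2 w))) b1 _ => t.
exact: borel_fun_map.
Qed.

Lemma borel_fun_shift (T : Type) i (f : name -> T) :
  borel_fun f -> borel_fun (fun w => f (shift i w)).
Proof. by move=> bf t; exact: (borel_shift i (bf t)). Qed.

Lemma borel_fun_coord i : borel_fun (fun w => w i).
Proof.
case; first exact: borel_coord.
apply: (@borel_ext (fun w => ~ w i)); last exact/borel_not/borel_coord.
by move=> w; case: (w i); split.
Qed.

(** A total choice, with default 0, that needs no decidability. Its value depends on the predicate
    alone, so a choice from a shift-invariant predicate is constant on orbits. *)
Definition least (P : nat -> Prop) : nat :=
  xget 0%N [set n | P n /\ forall m, P m -> (n <= m)%N].

Lemma leastP (P : nat -> Prop) n : P n ->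
  P (least P) /\ forall m, P m -> (least P <= m)%N.
Proof.
move=> Pn; have ex : exists n, `[< P n >] by exists n; apply/asboolP.
rewrite /least; case: xgetP => [y -> //|].
case: (ex_minnP ex) => m /asboolP Pm mmin /(_ m) []; split=> // k /asboolP; exact: mmin.
Qed.

Lemma leastN (P : nat -> Prop) : (forall n, ~ P n) -> least P = 0%N.
Proof. by move=> nP; rewrite /least; case: xgetP => // y _ [/nP]. Qed.

Lemma borel_least (P : nat -> name -> Prop) :
  (forall n, borel_pred (P n)) -> borel_fun (fun w => least (P ^~ w)).
Proof.
move=> bP t.
apply: (@borel_ext (fun w => (P t w /\ forall m, P m w -> (t <= m)%N) \/
   ((forall m, ~ P m w) /\ t = 0%N))).
  move=> w; split.
    case=> [[Pt tmin]|[nP ->]]; last exact: leastN.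
    have [Pl lmin] := leastP (P := P ^~ w) Pt.
    by apply/eqP; rewrite eqn_leq tmin ?lmin.
  have [[n Pn]|nP] := pselect (exists n, P n w).
    by have [Pl lmin] := leastP (P := P ^~ w) Pn; move=> <-; left.
  rewrite (@leastN (P ^~ w)) => [<-|m Pm]; last by apply: nP; exists m.
  by right; split=> // m Pm; apply: nP; exists m.
apply: borel_or; apply: borel_and => //.
- by apply: borel_all => m; apply: borel_imply; [exact: bP|exact: borel_const].
- by apply: borel_all => m; apply: borel_not.
- exact: borel_const.
Qed.

(** * Equivariant maps of cells *)

(* [(i, u)] is the copy number [u] of the point [i] of the orbit. *)
Definition cell : Type := (int * nat)%type.

(* [c w u] is the image of the cell [(0, u)] along the name [w]; [act c w] is
   the equivariant extension of this rule to all cells. *)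
Definition act (c : name -> nat -> cell) (w : name) (x : cell) : cell :=
  (x.1 + (c (shift x.1 w) x.2).1, (c (shift x.1 w) x.2).2).

Definition cell_comp (c2 c1 : name -> nat -> cell) (w : name) (u : nat) : cell :=
  act c2 w (c1 w u).

Lemma act_comp c2 c1 w x : act (cell_comp c2 c1) w x = act c2 w (act c1 w x).
Proof. by case: x => i u; rewrite /act /cell_comp /act /= shiftD addrA (addrC i). Qed.

Lemma act_shift c w i x :
  act c w (i + x.1, x.2) = (i + (act c (shift i w) x).1, (act c (shift i w) x).2).
Proof. by rewrite /act /= shiftD (addrC x.1 i) addrA. Qed.

Lemma borel_act c w0 :
  (forall u, borel_fun (c ^~ u)) -> borel_fun (fun w => act c w w0).
Proof.
case: w0 => i u bc; rewrite /act /=.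
apply: (borel_fun_map2 (fun a b => (i + a, b))
   (f1 := fun w => (c (shift i w) u).1) (f2 := fun w => (c (shift i w) u).2)).
  by apply: (borel_fun_map fst); exact: (borel_fun_shift i (bc u)).
by apply: (borel_fun_map snd); exact: (borel_fun_shift i (bc u)).
Qed.

Lemma borel_cell_comp c2 c1 :
  (forall u, borel_fun (c2 ^~ u)) -> (forall u, borel_fun (c1 ^~ u)) ->
  forall u, borel_fun ((cell_comp c2 c1) ^~ u).
Proof.
move=> b2 b1 u; apply: (borel_fun_bind (g := fun t w => act c2 w t)); first exact: b1.
by move=> t; exact: borel_act.
Qed.

(** * Parenthesis matching along an orbit *)

(* A cell [(i, u)] with [u < d i] is an opening parenthesis, and position [j]
   carries [s j] closing parentheses, read after the opening ones at [j].  The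
   level of [(i, u)] is [u] above the height at [i], so it is closed at the first
   position after which the height has dropped to at most that level. *)
Section matching.
Variables d s : name -> nat.

Fixpoint height (w : name) (m : nat) : int :=
  if m is m'.+1 then height w m' + (d (shift m' w))%:Z - (s (shift m' w))%:Z else 0.

Lemma heightD w a b : height w (a + b) = height w a + height (shift a w) b.
Proof.
elim: b => [|b IH] /=; first by rewrite addn0 addr0.
by rewrite addnS /= IH shiftD -PoszD (addnC b a) !addrA.
Qed.

Definition pop (w : name) (u : nat) : nat :=
  least (fun m => height w m.+1 <= u%:Z).

(** The closings at position [pop w u] remove levels from [height + d - 1] downwards, so exactly
    [height + d - 1 - u] of them precede the one that closes level [u]. *)
Definition paren_match (w : name) (u : nat) : cell :=
  ((pop w u)%:Z,
   absz (height w (pop w u) + (d (shift (pop w u) w))%:Z - 1 - u%:Z)%R).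

(** A negative height lies below every level, so level [u] does get closed. It is open before the
    closings at [pop w u] and closed after them, which puts the index between 0 and [s]. *)
Lemma paren_matchP w u : (u < d w)%N -> (exists m, height w m < 0) ->
  [/\ forall m, height w m.+1 <= u%:Z -> (pop w u <= m)%N,
      (paren_match w u).2%:Z =
        height w (pop w u) + (d (shift (pop w u) w))%:Z - 1 - u%:Z &
      ((paren_match w u).2 < s (shift (paren_match w u).1 w))%N].
Proof.
move=> ud [[|m] hm] //.
have hm' : height w m.+1 <= u%:Z by lia.
have [hp pmin] := leastP (P := fun m => height w m.+1 <= u%:Z) hm'.
rewrite -/(pop w u) in hp pmin.
have h2 : (paren_match w u).2%:Z =
        height w (pop w u) + (d (shift (pop w u) w))%:Z - 1 - u%:Z.
  rewrite /paren_match /= gez0_abs //.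
  (* Level [u] is open on arrival: at position 0 because [u < d w], at a later position by
     minimality of [pop]. Hence [absz] changes nothing. *)
  move: pmin; case: (pop w u) => [|k] pmin; first by rewrite /= shift0; lia.
  have : ~~ (height w k.+1 <= u%:Z) by apply/negP => /pmin; rewrite ltnn.
  by lia.
split=> //; move: hp; rewrite -ltz_nat h2 /=; lia.
Qed.

(** A common closing parenthesis forces a common level. If the second cell opened [a > 0] positions
    later, the height there would be at most the level of the first cell, which would then have been
    closed before position [a]. *)
Lemma paren_match_inj w x y :
  (x.2 < d (shift x.1 w))%N -> (y.2 < d (shift y.1 w))%N ->
  (forall i, exists m, height (shift i w) m < 0) ->
  act paren_match w x = act paren_match w y -> x = y.
Proof.
move=> + + hw; wlog : x y / x.1 <= y.1.
  move=> W xd yd e; have [xy|/ltW yx] := leP x.1 y.1; first exact: W.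
  by apply/esym; exact: W.
case: x y => i u [i' u'] /= ii' ud ud'.
have [a Ei'] : exists a : nat, i' = i + a%:Z by exists (absz (i' - i)%R); lia.
move: ud' {ii'}; rewrite {}Ei' {i'} => ud'.
have E : shift (i + a%:Z) w = shift a (shift i w) by rewrite shiftD addrC.
have [_ m2 _] := paren_matchP ud' (hw _).
have [m1min m1 _] := paren_matchP ud (hw i).
rewrite /act /=; case=> e1 e2.
move: m1 m2 => /= + m2; rewrite e2 m2 => {e2 m2}.
move: e1; rewrite -addrA => /addrI.
move: ud ud' m1min; rewrite E; set w0 := shift i w => ud ud' m1min [e1].
rewrite e1 heightD shiftD -PoszD (addnC _ a) => e2.
have hu : u%:Z = height w0 a + u'%:Z by lia.
have a0 : a = 0%N.
  case: a E e1 ud' hu {e2} => // a _ e1 _ hu.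
  by have := m1min a; rewrite e1 hu; lia.
by move: hu; rewrite a0 /= add0r addr0 => -[->].
Qed.

Hypotheses (bd : borel_fun d) (bs : borel_fun s).

Lemma borel_height m : borel_fun (height ^~ m).
Proof.
elim: m => [|m IH] /=; first exact: borel_fun_cst.
apply: (borel_fun_map2 (fun a b => a - Posz b)
   (f1 := fun w => height w m + (d (shift m w))%:Z)); last exact: borel_fun_shift.
by apply: (borel_fun_map2 (fun a b => a + Posz b)) => //; exact: borel_fun_shift.
Qed.

Lemma borel_paren_match u : borel_fun (paren_match ^~ u).
Proof.
apply: (borel_fun_bind (f := pop ^~ u) (g := fun k w =>
  (k%:Z, absz (height w k + (d (shift k w))%:Z - 1 - u%:Z)%R))).
  apply: borel_least => m; apply: (borel_pred_bind (f := height ^~ m.+1)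
      (P := fun h _ => h <= u%:Z)).
    exact: borel_height.
  by move=> t; exact: borel_const.
move=> k; apply: (borel_fun_map2 (fun a b => (k%:Z, absz (a + Posz b - 1 - u%:Z)%R))).
  exact: borel_height.
exact: borel_fun_shift.
Qed.

End matching.

(* Unboundedness, unlike the mere existence of negative values, does not depend
   on the origin. *)
Definition unbounded_below (h : nat -> int) := forall K : nat, exists n, h n < - K%:Z.

(** Moving the origin by one changes all heights by the constant [height d s v 1], which the
    threshold absorbs. *)
Lemma unbounded_below_shift d s i w :
  unbounded_below (height d s (shift i w)) <-> unbounded_below (height d s w).
Proof.
have step v : unbounded_below (height d s (shift 1%:Z v)) <-> unbounded_below (height d s v).
  have [K0 hK0] : exists K0 : nat, - K0%:Z <= height d s v 1 <= K0%:Z.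
    by exists (absz (height d s v 1)); lia.
  split=> h K; have [[|n] hn] := h (K + K0)%N.
  - by exists 0%N; move: hn => /=; lia.
  - by exists n.+2; rewrite -[n.+2]add1n heightD; lia.
  - by exists 0%N; move: hn => /=; lia.
  - by exists n; move: hn; rewrite -add1n heightD; lia.
elim/int_rect: i w => [|n IH|n IH] w; first by rewrite shift0.
- by rewrite -addn1 PoszD -shiftD IH step.
- rewrite -(step (shift _ w)) shiftD.
  by have -> : 1%:Z + - n.+1%:Z = - n%:Z by lia.
Qed.

Lemma borel_unbounded_below d s : borel_fun d -> borel_fun s ->
  borel_pred (fun w => unbounded_below (height d s w)).
Proof.
move=> bd bs; apply: borel_all => K; apply: borel_ex => n.
apply: (borel_pred_bind (f := height d s ^~ n) (P := fun h _ => h < - K%:Z)).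
  exact: borel_height.
by move=> t; exact: borel_const.
Qed.

(** * Squeezing [p + 1] layers of an orbit into [p] *)

Section oscillation.
Variables p q : nat.

Definition visit_load (w : name) : nat := q * w 0.

Lemma borel_visit_load : borel_fun visit_load.
Proof. by apply: (borel_fun_map (fun b : bool => (q * b)%N)); exact: borel_fun_coord. Qed.

(** With [S(n)] the number of visits before time [n], the clauses say that [q S(n) - p n] and
    [(p + 1) n - q S(n)] are unbounded below. They make both matchings total: visits into [p]
    layers, and [p + 1] layers into visits. *)
Definition oscillates (w : name) :=
  unbounded_below (height visit_load (fun=> p) w) /\
  unbounded_below (height (fun=> p.+1) visit_load w).

Lemma oscillates_shift i w : oscillates (shift i w) <-> oscillates w.
Proof. by rewrite /oscillates !unbounded_below_shift. Qed.

Lemma borel_oscillates : borel_pred oscillates.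
Proof.
by apply: borel_and; apply: borel_unbounded_below;
  first [exact: borel_visit_load | exact: borel_fun_cst].
Qed.

Definition squeeze : name -> nat -> cell :=
  cell_comp (paren_match visit_load (fun=> p)) (paren_match (fun=> p.+1) visit_load).

Lemma borel_squeeze u : borel_fun (squeeze ^~ u).
Proof.
by apply: borel_cell_comp => {}u; apply: borel_paren_match;
  first [exact: borel_visit_load | exact: borel_fun_cst].
Qed.

Section orbit.
Variables (w : name) (osc : oscillates w).

Let neg1 i : exists m, height visit_load (fun=> p) (shift i w) m < 0.
Proof. by have [/(_ 0%N)] := (oscillates_shift i w).2 osc. Qed.

Let neg2 i : exists m, height (fun=> p.+1) visit_load (shift i w) m < 0.
Proof. by have [_ /(_ 0%N)] := (oscillates_shift i w).2 osc. Qed.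

Let mid x : (x.2 <= p)%N ->
  let y := act (paren_match (fun=> p.+1) visit_load) w x in
  (y.2 < visit_load (shift y.1 w))%N.
Proof.
move=> xp /=.
have [_ _] := @paren_matchP (fun=> p.+1) visit_load (shift x.1 w) x.2 xp (neg2 _).
by rewrite shiftD addrC.
Qed.

Lemma squeeze_lt x : (x.2 <= p)%N -> ((act squeeze w x).2 < p)%N.
Proof.
move=> /mid yd; rewrite act_comp.
by have [] := @paren_matchP visit_load (fun=> p) _ _ yd (neg1 _).
Qed.

Lemma squeeze_inj x y : (x.2 <= p)%N -> (y.2 <= p)%N ->
  act squeeze w x = act squeeze w y -> x = y.
Proof.
move=> xp yp; rewrite !act_comp => /paren_match_inj.
move=> /(_ (mid xp) (mid yp) neg1) /paren_match_inj; apply=> //; exact: neg2.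
Qed.

Lemma iter_squeeze_lt i n : ((iter n.+1 (act squeeze w) (i, p)).2 < p)%N.
Proof. by elim: n => [|n IH]; apply: squeeze_lt => //; exact: ltnW. Qed.

(** Squeezes are cancelled on both sides until one side runs out; unequal counts would equate a cell
    of layer [p] with one of a lower layer. *)
Lemma iter_squeeze_inj i j m n :
  iter m.+1 (act squeeze w) (i, p) = iter n.+1 (act squeeze w) (j, p) ->
  i = j /\ m = n.
Proof.
have le k l : ((iter l (act squeeze w) (k, p)).2 <= p)%N.
  by case: l => // l; exact/ltnW/iter_squeeze_lt.
elim: m n => [|m IH] n e.
  have := squeeze_inj (le i 0%N) (le j n) e; case: n {e} => [[]//|n e].
  by have := iter_squeeze_lt j n; rewrite -e ltnn.
have := squeeze_inj (le i m.+1) (le j n) e; case: n {e} => [e|n /IH[-> ->] //].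
by have := iter_squeeze_lt i m; rewrite e ltnn.
Qed.

End orbit.

(* The squeeze map sends layers [0..p] injectively to layers [0..p-1], so the
   iterated images of layer [p] are pairwise disjoint. *)
Definition copy (w : name) (n : nat) : cell := iter n.+1 (act squeeze w) (0, p).

Lemma copy_shift w i n :
  iter n.+1 (act squeeze w) (i, p) = (i + (copy (shift i w) n).1, (copy (shift i w) n).2).
Proof.
rewrite /copy; elim: n => [|n IH].
  by rewrite /= -[in LHS](addr0 i) (act_shift _ _ _ (0, p)).
by rewrite iterS IH act_shift -iterS.
Qed.

Lemma copy_inj w i j m n : oscillates w ->
  i + (copy (shift i w) m).1 = j + (copy (shift j w) n).1 ->
  (copy (shift i w) m).2 = (copy (shift j w) n).2 -> i = j /\ m = n.
Proof.
move=> osc e1 e2; apply: (iter_squeeze_inj osc).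
by rewrite !copy_shift e1 e2.
Qed.

Lemma borel_iter_squeeze n : borel_fun (fun w => iter n (act squeeze w) (0, p)).
Proof.
elim: n => [|n IH] /=; first exact: borel_fun_cst.
apply: (borel_fun_bind (g := fun x w => act squeeze w x)) => // x.
by apply: borel_act => u; exact: borel_squeeze.
Qed.

Lemma borel_copy n : borel_fun (copy ^~ n).
Proof. exact: (borel_iter_squeeze n.+1). Qed.

(** * Distinct addresses inside a single layer *)

Definition rich (c : nat) (w : name) :=
  forall N, exists n, (N <= n)%N /\ (copy w n).2 = c.

Lemma borel_rich c : borel_pred (rich c).
Proof.
apply: borel_all => N; apply: borel_ex => n; apply: borel_and; first exact: borel_const.
by apply: (borel_fun_map snd); exact: borel_copy.
Qed.

(** Pigeonhole: infinitely many copies land in only [p] layers. *)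
Lemma rich_exists w : oscillates w -> exists c, rich c w.
Proof.
move=> osc; apply: contrapT => /forallNP nr.
have /choice [N hN] c : exists N, forall n, (N <= n)%N -> (copy w n).2 <> c.
  have /existsNP[N /forallNP hN] := nr c.
  by exists N => n Nn e; exact: (hN n).
pose M := \max_(c < p) N c.
have cp : ((copy w M).2 < p)%N := iter_squeeze_lt osc 0 M.
apply: (hN _ M) (erefl (copy w M).2).
exact: (leq_bigmax (Ordinal cp)).
Qed.

(* Distinct layers may collide when projected to the orbit, so a single layer
   has to be used along the whole orbit. *)
Definition colour (w : name) : nat := least (fun c => exists i, rich c (shift i w)).

Lemma colour_shift i w : colour (shift i w) = colour w.
Proof.
congr least; apply/funext => c; apply/propext; split=> -[j].
  by rewrite shiftD; exists (j + i).
by move=> h; exists (j - i); rewrite shiftD subrK.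
Qed.

Lemma borel_colour : borel_fun colour.
Proof.
apply: borel_least => c; apply: borel_ex => i; exact: (borel_shift i (borel_rich c)).
Qed.

Definition int_code (e : nat) : int := odflt 0 (unpickle e).

(** The common layer is only known to be rich at some point of the orbit, so each point selects a
    displacement leading to such a point. *)
Definition base (w : name) : int :=
  int_code (least (fun e => rich (colour w) (shift (int_code e) w))).

Lemma rich_base w : oscillates w -> rich (colour w) (shift (base w) w).
Proof.
move=> osc; have [c rc] := rich_exists osc.
have ex : exists i, rich c (shift i w) by exists 0; rewrite shift0.
have [[i ri] _] := leastP (P := fun c => exists i, rich c (shift i w)) ex.
apply: (leastP (P := fun e => rich (colour w) (shift (int_code e) w)) (n := pickle i) _).1.
by rewrite /int_code pickleK.
Qed.

Lemma borel_base : borel_fun base.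
Proof.
apply: (borel_fun_map int_code).
apply: (borel_fun_bind (f := colour)
  (g := fun c w => least (fun e => rich c (shift (int_code e) w)))).
  exact: borel_colour.
move=> c; apply: borel_least => e; exact: (borel_shift (int_code e) (borel_rich c)).
Qed.

Fixpoint hits (w : name) (c n : nat) : nat :=
  if n is m.+1 then (hits w c m + ((copy w m).2 == c))%N else 0%N.

Lemma borel_hits c n : borel_fun (fun w => hits w c n).
Proof.
elim: n => [|n IH] /=; first exact: borel_fun_cst.
apply: (borel_fun_map2 (fun a b => (a + (b.2 == c))%N)
  (f1 := fun w => hits w c n) (f2 := copy ^~ n)) => //.
exact: borel_copy.
Qed.

Definition nth_hit (w : name) (c N : nat) : nat :=
  least (fun n => (copy w n).2 = c /\ hits w c n = N).

Lemma nth_hitP w c N : rich c w ->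
  (copy w (nth_hit w c N)).2 = c /\ hits w c (nth_hit w c N) = N.
Proof.
move=> rc; suff [n hn] : exists n, (copy w n).2 = c /\ hits w c n = N.
  exact: (leastP (P := fun n => (copy w n).2 = c /\ hits w c n = N) hn).1.
(* From [m], advance to the first copy in layer [c]; no hit is counted on the way. *)
have next m : exists n, (copy w n).2 = c /\ hits w c n = hits w c m.
  have [k [/subnKC <-]] := rc m; move: (k - m)%N => d.
  elim: d m => [|d IH] m ck.
    by exists m; rewrite addn0 in ck.
  have [cm|cm] := eqVneq (copy w m).2 c; first by exists m.
  have [|n [cn hn]] := IH m.+1; first by rewrite addSnnS.
  by exists n; rewrite hn /= (negbTE cm) addn0.
elim: N => [|N [n [cn hn]]]; first exact: (next 0%N).
have [k [ck hk]] := next n.+1; exists k.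
by rewrite hk -[hits w c n.+1]/(hits w c n + ((copy w n).2 == c))%N hn cn eqxx addn1.
Qed.

Lemma borel_nth_hit c N : borel_fun (fun w => nth_hit w c N).
Proof.
apply: borel_least => n; apply: borel_and.
  by apply: (borel_fun_map snd); exact: borel_copy.
exact: borel_hits.
Qed.

(* Each point uses cells owned by its nearby rich point [base w], which tells its
   clients apart by their displacement. *)
Definition slot (w : name) (n : nat) : int :=
  base w + (copy (shift (base w) w)
    (nth_hit (shift (base w) w) (colour w) (pickle (base w, n)))).1.

(** All cells used lie in layer [colour w], so equal positions mean equal cells, hence the same
    owner and the same copy. Its hit count decodes to the displacement and the index, and owner and
    displacement determine the point. *)
Lemma slot_inj w i j m n : oscillates w ->
  i + slot (shift i w) m = j + slot (shift j w) n -> i = j /\ m = n.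
Proof.
move=> osc.
have slotE k l : k + slot (shift k w) l = (k + base (shift k w)) +
    (copy (shift (k + base (shift k w)) w) (nth_hit (shift (k + base (shift k w)) w)
      (colour w) (pickle (base (shift k w), l)))).1.
  rewrite /slot (colour_shift k w); move: (base (shift k w)) => b.
  by rewrite shiftD (addrC b k) addrA.
have richE k : rich (colour w) (shift (k + base (shift k w)) w).
  have := rich_base ((oscillates_shift k w).2 osc).
  by rewrite (colour_shift k w); move: (base (shift k w)) => b; rewrite shiftD addrC.
rewrite (slotE i m) (slotE j n); move: (richE i) (richE j).
move: (base (shift i w)) (base (shift j w)) (colour w) => b b' c rb rb' e.
have [cb hb] := nth_hitP (pickle (b, m)) rb.
have [cb' hb'] := nth_hitP (pickle (b', n)) rb'.
have [ab hit] := copy_inj osc e (etrans cb (esym cb')).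
have : pickle (b, m) = pickle (b', n) by rewrite -hb -hb' hit ab.
move=> /(pcan_inj pickleK)[eb ->]; split=> //.
by move: ab; rewrite eb => /addIr.
Qed.

Lemma borel_slot n : borel_fun (slot ^~ n).
Proof.
apply: (borel_fun_bind (f := base) (g := fun b w => b + (copy (shift b w)
    (nth_hit (shift b w) (colour w) (pickle (b, n)))).1)); first exact: borel_base.
move=> b; apply: (borel_fun_bind (f := colour) (g := fun c w => b + (copy (shift b w)
    (nth_hit (shift b w) c (pickle (b, n)))).1)); first exact: borel_colour.
move=> c; apply: (borel_fun_bind (f := fun w => nth_hit (shift b w) c (pickle (b, n)))
    (g := fun k w => b + (copy (shift b w) k).1)).
  by apply: (borel_fun_shift b (f := fun w => nth_hit w c _)); exact: borel_nth_hit.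
move=> k; apply: (borel_fun_map (fun x => b + x.1) (f := fun w => copy (shift b w) k)).
by apply: (borel_fun_shift b (f := copy ^~ k)); exact: borel_copy.
Qed.

End oscillation.

(** * A choice of rates constant on orbits *)

Definition oscillation (w : name) (e : nat) : Prop :=
  if unpickle e is Some x then oscillates x.1 x.2 w else False.

Definition diverges (w : name) := exists p q, oscillates p q w.

Lemma borel_diverges : borel_pred diverges.
Proof. by apply: borel_ex => p; apply: borel_ex => q; exact: borel_oscillates. Qed.

Lemma diverges_shift i w : diverges (shift i w) <-> diverges w.
Proof. by split=> -[p [q /(oscillates_shift p q i w) osc]]; exists p, q. Qed.

(** All points of an orbit must use the same squeeze map, so one pair is fixed by its least code, a
    shift-invariant choice. *)
Definition rates (w : name) : nat * nat :=
  odflt (0, 0)%N (unpickle (least (oscillation w))).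

Lemma ratesP w : diverges w -> oscillates (rates w).1 (rates w).2 w.
Proof.
move=> [p [q osc]]; have hpq : oscillation w (pickle (p, q)).
  by rewrite /oscillation pickleK.
have [] := leastP hpq; rewrite /rates {1}/oscillation.
by case: unpickle.
Qed.

Lemma rates_shift i w : rates (shift i w) = rates w.
Proof.
rewrite /rates; congr (odflt _ (unpickle (least _))); apply/funext => e.
rewrite /oscillation; case: unpickle => // x.
by apply/propext; exact: oscillates_shift.
Qed.

Lemma borel_rates : borel_fun rates.
Proof.
apply: (borel_fun_map (fun e => odflt (0, 0)%N (unpickle e))).
apply: (borel_least (P := fun e w => oscillation w e)) => e.
rewrite /oscillation; case: unpickle => [x|]; last exact: borel_const.
exact: borel_oscillates.
Qed.

Lemma distinct_addresses :
  exists a : name -> nat -> int, (forall n, borel_fun (a ^~ n)) /\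
    forall w i j m n, diverges w ->
      i + a (shift i w) m = j + a (shift j w) n -> i = j /\ m = n.
Proof.
exists (fun w n => slot (rates w).1 (rates w).2 w n); split=> [n|w i j m n].
  apply: (borel_fun_bind (f := rates) (g := fun x w => slot x.1 x.2 w n)).
    exact: borel_rates.
  by move=> x; exact: borel_slot.
move=> /ratesP osc; rewrite (rates_shift i w) (rates_shift j w); exact: slot_inj.
Qed.

(** * Divergence of the averages as oscillation *)

Lemma not_cvg_oscillation (R : realType) (u : nat -> R) :
  (forall n, 0 <= u n <= 1) -> ~ cvgn u ->
  exists a b, [/\ a < b, forall N, exists2 n, (N <= n)%N & u n < a &
    forall N, exists2 n, (N <= n)%N & b < u n].
Proof.
move=> u01 ncu; apply: contrapT => nab; apply: ncu.
(* [sup E] is the lower limit of [u]; it is shown to be the limit unless two levels are separated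
   infinitely often. *)
pose E := [set a | exists N, forall n, (N <= n)%N -> a <= u n].
have ubE : has_ubound E.
  by exists 1 => a [N /(_ N (leqnn N))] /le_trans; apply; have /andP[] := u01 N.
have supE : has_sup E by split=> //; exists 0, 0%N => n _; have /andP[] := u01 n.
apply: (cvgP (sup E)); apply/cvgrPdist_le => e e0.
have [a [N1 aN1] ea] := sup_adherent e0 supE.
have [N2 hN2] : exists N2, forall n, (N2 <= n)%N -> u n <= sup E + e.
  (* If [u] eventually stayed above [sup E + e / 2], this number would belong to [E], beyond its
     supremum. *)
  apply: contrapT => /forallNP hi; apply: nab; exists (sup E + e / 2), (sup E + e); split.
  - by rewrite ltrD2l; lra.
  - move=> N; apply: contrapT => lo.
    suff /(ub_le_sup ubE) : E (sup E + e / 2) by lra.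
    exists N => n Nn; rewrite leNgt; apply/negP => un.
    by apply: lo; exists n.
  - move=> N; have /existsNP[n /not_implyP[Nn /negP]] := hi N.
    by rewrite -ltNge => un; exists n.
exists (maxn N1 N2) => // n /=; rewrite geq_max => /andP[/aN1 h1 /hN2 h2].
by rewrite ler_norml; apply/andP; split; lra.
Qed.

Definition visits (w : name) (n : nat) : nat := \sum_(i < n) w i.

Lemma visits_le w n : (visits w n <= n)%N.
Proof.
rewrite -[leqRHS]card_ord -sum1_card; apply: leq_sum => i _.
by case: (w i).
Qed.

Lemma height_visits p q w n :
  (height (visit_load q) (fun=> p) w n = (q * visits w n)%N%:Z - (p * n)%N%:Z) *
  (height (fun=> p.+1) (visit_load q) w n = (p.+1 * n)%N%:Z - (q * visits w n)%N%:Z).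
Proof.
elim: n => [|n [IH1 IH2]]; first by rewrite /= /visits big_ord0 !muln0.
rewrite /= IH1 IH2 /visits big_ord_recr /= /visit_load /shift addr0.
by rewrite !mulnDr !mulnS; split; lia.
Qed.

Section means.
Variables (R : realType) (w : name).

Let mean (n : nat) : R := n.+1%:R^-1 * (visits w n.+1)%:R.

Let meanE n : (visits w n.+1)%:R = mean n * n.+1%:R.
Proof. by rewrite /mean mulrAC mulVf ?mul1r // pnatr_eq0. Qed.

Let archi (r d : R) : 0 < d -> exists N : nat, r < N%:R * d.
Proof.
move=> d0; exists (Num.truncn (Num.max 0 (r / d))).+1.
rewrite -ltr_pdivrMr //; apply: le_lt_trans (truncnS_gt _).
by rewrite le_max lexx orbT.
Qed.

Lemma mean_not_cvg : ~ cvgn mean -> diverges w.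
Proof.
move=> /not_cvg_oscillation[n|a [b [ab lo hi]]].
  rewrite /mean mulr_ge0 ?invr_ge0 ?ler0n //=.
  by rewrite ler_pdivrMl ?ltr0n // mulr1 ler_nat visits_le.
(* A gap of more than 2 between [q a] and [q b] leaves room for both [p] and [p + 1] strictly
   between them. *)
have [q hq] := @archi 2 (b - a) ltac:(by rewrite subr_gt0).
have a0 : 0 <= q%:R * a.
  have [n _ un] := lo 0%N; rewrite mulr_ge0 ?ler0n //; apply: ltW; apply: le_lt_trans un.
  by rewrite /mean mulr_ge0 ?invr_ge0 ?ler0n.
pose p := (Num.truncn (q%:R * a)).+1.
have pgt : q%:R * a < p%:R by exact: truncnS_gt.
have ple : p%:R <= q%:R * a + 1 by rewrite /p -natr1 lerD2r; have /andP[] := truncn_itv a0.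
have plt : p.+1%:R < q%:R * b by rewrite -natr1; lra.
exists p, q; split=> K.
(* The deficit at time [n + 1] is at least [(n + 1) (p - q a)], which exceeds [K] once [n] is at
   least [N]. *)
- have [N hN] := @archi K%:R (p%:R - q%:R * a) ltac:(by rewrite subr_gt0).
  have [n Nn un] := lo N; exists n.+1; rewrite height_visits.
  suff : (q * visits w n.+1 + K < p * n.+1)%N by lia.
  rewrite -(ltr_nat R) natrD !natrM meanE.
  have h1 : q%:R * (mean n * n.+1%:R) <= q%:R * a * n.+1%:R.
    by rewrite mulrA ler_wpM2r ?ler0n // ler_wpM2l ?ler0n // ltW.
  have h2 : N%:R * (p%:R - q%:R * a) <= n.+1%:R * (p%:R - q%:R * a).
    by rewrite ler_wpM2r ?ler_nat ?leqW // subr_ge0 ltW.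
  by lra.
- have [N hN] := @archi K%:R (q%:R * b - p.+1%:R) ltac:(by rewrite subr_gt0).
  have [n Nn un] := hi N; exists n.+1; rewrite height_visits.
  suff : (p.+1 * n.+1 + K < q * visits w n.+1)%N by lia.
  rewrite -(ltr_nat R) natrD !natrM meanE.
  have h1 : q%:R * b * n.+1%:R <= q%:R * (mean n * n.+1%:R).
    by rewrite [leRHS]mulrA ler_wpM2r ?ler0n // ler_wpM2l ?ler0n // ltW.
  have h2 : N%:R * (q%:R * b - p.+1%:R) <= n.+1%:R * (q%:R * b - p.+1%:R).
    by rewrite ler_wpM2r ?ler_nat ?leqW // subr_ge0 ltW.
  by lra.
Qed.

(** A limit would be at most [p / q] and at least [(p + 1) / q]. *)
Lemma diverges_not_cvg : diverges w -> ~ cvgn mean.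
Proof.
move=> [p [q [lo hi]]] /cvg_ex[l ml].
have q0 : (0 < q)%N.
  by case: q lo hi => // lo hi; have [n] := hi 0%N; rewrite height_visits; lia.
have qp : 0 < q%:R :> R by rewrite ltr0n.
have lp : l <= p%:R / q%:R.
  rewrite leNgt; apply/negP => /(cvgr_gt l ml) [N _ hN].
  (* The height at [n] is at least [- p n], so this threshold forces [n] beyond [N + 1], where the
     bound on the means applies. *)
  have [n] := lo (p * N.+1)%N; rewrite height_visits => hn.
  have Nn : (N.+1 < n)%N by rewrite -(ltn_pmul2l (m := p)); lia.
  case: n Nn hn => // n Nn hn.
  have := hN n (ltnW Nn); rewrite /= ltr_pdivrMr // /mean -mulrA ltr_pdivlMl ?ltr0n //.
  by rewrite -!natrM ltr_nat; lia.
have lq : p.+1%:R / q%:R <= l.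
  rewrite leNgt; apply/negP => /(cvgr_lt l ml) [N _ hN].
  have [n] := hi (q * N.+1)%N; rewrite height_visits => hn.
  have Nn : (N.+1 < n)%N.
    rewrite -(ltn_pmul2l q0); have := visits_le w n; rewrite -(leq_pmul2l q0); lia.
  case: n Nn hn => // n Nn hn.
  have := hN n (ltnW Nn); rewrite /= ltr_pdivlMr // /mean -mulrA ltr_pdivrMl ?ltr0n //.
  by rewrite -!natrM ltr_nat; lia.
have := le_trans lq lp; rewrite ler_pM2r ?invr_gt0 // ler_nat; lia.
Qed.

End means.

(** * Countable generation and traces of sigma-algebras *)

Lemma separable_open_base (R : realType) (P : pseudoMetricType R) (D : set P) :
  countable D -> dense D ->
  exists W : nat -> set P, (forall k, open (W k)) /\
    forall U, open U -> U = \bigcup_(k in [set k | W k `<=` U]) W k.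
Proof.
move=> /countable_injP[e einj] dD.
pose rad (n : nat) : R := n.+1%:R^-1.
have rad_gt0 n : 0 < rad n by rewrite invr_gt0.
(* Interiors are taken because abstract balls need not be open. The union has at most one term, [e]
   being injective on [D], and so needs no default centre. *)
pose W k := if unpickle k is Some (a, n) then
  \bigcup_(d in [set d | D d /\ e d = a]) (ball d (rad n))° else set0 : set P.
exists W; split=> [k|U oU].
  rewrite /W; case: unpickle => [[a n]|]; last exact: open0.
  by apply: bigcup_open => d _; exact: open_interior.
apply/seteqP; split=> [x Ux|x [k /= WU Wx]]; last exact: WU.
have [r /= r0 rU] : nbhs_ball x U.
  by apply/nbhs_ballP; move: oU; rewrite openE => /(_ x Ux).
(* A centre within [rad n / 2] of [x] keeps [x] interior to its ball of radius [rad n], and that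
   ball stays within [3/2 rad n < r] of [x]. *)
have [n hn] : exists n, rad n < r / 2.
  exists (Num.truncn (r / 2)^-1).
  by rewrite /rad invf_plt ?posrE ?divr_gt0 // truncnS_gt.
have [d [dx Dd]] : (ball x (rad n / 2))° `&` D !=set0.
  apply: dD; last exact: open_interior.
  by exists x; exact/nbhsx_ballx/divr_gt0.
have xd : ball d (rad n / 2) x by apply/ball_sym; exact: interior_subset dx.
have Wk : W (pickle (e d, n)) = (ball d (rad n))°.
  rewrite /W pickleK; apply/seteqP; split=> [y [d' [Dd' ee]]|y dy]; last by exists d.
  by rewrite (einj d' d) ?inE.
exists (pickle (e d, n)); rewrite /= Wk.
  apply: subset_trans (@interior_subset _ _) _ => z dz; apply: rU.
  have : ball x (rad n / 2 + rad n) z by apply: ball_triangle dz; exact: ball_sym.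
  by apply: le_ball; have := rad_gt0 n; lra.
apply: (@filterS _ (nbhs x) _ (ball x (rad n / 2))); last exact/nbhsx_ballx/divr_gt0.
by move=> z xz; rewrite (splitr (rad n)); exact: ball_triangle xd xz.
Qed.

Section sigma_algebra_trace.
Variables (X : Type) (D : set X) (S : set (set X)).
Hypothesis sS : sigma_algebra D S.

Lemma sigma_bigcup_countType (I : countType) (F : I -> set X) :
  (forall i, S (F i)) -> S (\bigcup_i F i).
Proof.
case: sS => S0 _ SU SF.
have -> : \bigcup_i F i = \bigcup_n (if unpickle n is Some i then F i else set0).
  apply/seteqP; split=> [x [i _ Fx]|x [n _]].
    by exists (pickle i) => //; rewrite pickleK.
  by case: unpickle => // i Fx; exists i.
by apply: SU => n; case: unpickle.
Qed.

Lemma sigma_traceC P : S (P `&` D) -> S (~` P `&` D).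
Proof.
case: sS => _ SC _ /SC; suff -> : D `\` (P `&` D) = ~` P `&` D by [].
by apply/seteqP; split=> x; rewrite /setD /setI /setC /=; tauto.
Qed.

Lemma sigma_trace_bigcup (I : countType) (F : I -> set X) :
  (forall i, S (F i `&` D)) -> S ((\bigcup_i F i) `&` D).
Proof. by move=> SF; rewrite setI_bigcupl; exact: sigma_bigcup_countType. Qed.

Lemma sigma_traceI P Q : S (P `&` D) -> S (Q `&` D) -> S ((P `&` Q) `&` D).
Proof.
move=> /sigma_traceC SP /sigma_traceC SQ.
rewrite -(setCK (P `&` Q)); apply: sigma_traceC.
have -> : ~` (P `&` Q) = \bigcup_(b : bool) (if b then ~` P else ~` Q).
  rewrite setCI; apply/seteqP; split=> [x [?|?]|x [[] _ ?]];
    by [exists true|exists false|left|right].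
by apply: sigma_trace_bigcup => -[].
Qed.

(** Serves two sigma-algebras: the Borel sets, for measurability of what is read off the name, and
    the one generated by the partition, which must recover the addresses. *)
Lemma sigma_trace_pullback (nu : X -> name) (P : name -> Prop) :
  (forall i, S ([set x | nu x i] `&` D)) -> borel_pred P ->
  S ([set x | P (nu x)] `&` D).
Proof.
move=> Snu; elim=> [//|{}P _ IH|{}P _ IH]; first exact: sigma_traceC.
have -> : [set x | exists n, P n (nu x)] = \bigcup_n [set x | P n (nu x)].
  by apply/seteqP; split=> [x [n]|x [n _]]; exists n.
exact: sigma_trace_bigcup.
Qed.

End sigma_algebra_trace.

Lemma standard_borel_sigma_algebra (R : realType) (X : Type) (B : set (set X)) :
  standard_borel R B -> sigma_algebra setT B.
Proof.
move=> [P [f [_ _ ->]]]; split.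
- by exists set0; [exact: sigma_algebra0|rewrite preimage_set0].
- move=> _ [U sU <-]; exists (setT `\` U); first exact: sigma_algebraCD.
  by rewrite !setTD.
- move=> F BF.
  have /choice[G hG] k : exists U, <<s [set U : set P | open U] >> U /\ f @^-1` U = F k.
    by have [U] := BF k; exists U.
  exists (\bigcup_k G k).
    by apply: sigma_algebra_bigcup => k; have [] := hG k.
  by rewrite preimage_bigcup; apply: eq_bigcupr => k _; have [] := hG k.
Qed.

(** The [E n] come from a countable base; the sets whose pullback has its trace in [S] form a
    sigma-algebra containing the open sets. Traces allow the use on an invariant subset. *)
Lemma standard_borel_countably_generated (R : realType) (X : Type) (B : set (set X)) :
  standard_borel R B ->
  exists E : nat -> set X, (forall n, B (E n)) /\
    forall D S, sigma_algebra D S -> (forall n, S (E n `&` D)) ->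
      forall F, B F -> S (F `&` D).
Proof.
move=> [P [f [[[Q cQ dQ] _] _ ->]]].
have [W [oW Wbase]] := separable_open_base cQ dQ.
exists (fun n => f @^-1` W n); split=> [n|D S sS SW _ [U sU <-]].
  by exists (W n) => //; apply: sub_sigma_algebra; exact: oW.
pose G := [set V : set P | S ((f @^-1` V) `&` D)].
case: (sS) => S0 SC SU.
apply: (@smallest_sub _ _ _ G _ _ U sU).
  split.
  - by rewrite /G /= preimage_set0 set0I.
  - by move=> V; rewrite /G /= setTD preimage_setC; exact: sigma_traceC.
  - move=> V SV; rewrite /G /= preimage_bigcup; exact: (sigma_trace_bigcup sS).
move=> V oV; rewrite /G /= [V]Wbase // preimage_bigcup setI_bigcupl.
rewrite bigcup_mkcond; apply: SU => k.
by case: ifP => _.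
Qed.

(** * The integer action of an automorphism *)

Section two_sided_iteration.
Variables (X : Type) (T g : X -> X).
Hypotheses (Tg : cancel T g) (gT : cancel g T).

Definition ziter (i : int) (x : X) : X :=
  match i with Posz n => iter n T x | Negz n => iter n.+1 g x end.

Lemma ziterD (i j : int) x : ziter (i + j) x = ziter i (ziter j x).
Proof.
have zS (k : int) y : ziter (1 + k) y = T (ziter k y).
  case: k => [k|[|k]]; rewrite ?NegzE; first by rewrite -PoszD add1n.
    by rewrite subrr /= gT.
  have -> : 1 - k.+2%:Z = Negz k by rewrite NegzE; lia.
  by rewrite /= gT.
have zP (k : int) y : ziter (-1 + k) y = g (ziter k y).
  have e : k = 1 + (-1 + k) by lia.
  by rewrite [in RHS]e zS Tg.
elim/int_rect: i => [|n IH|n IH]; first by rewrite add0r.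
- have -> : n.+1%:Z + j = 1 + (n%:Z + j) by lia.
  by rewrite -[n.+1%:Z]/(1 + n%:Z) !zS IH.
- have -> : - n.+1%:Z + j = -1 + (- n%:Z + j) by lia.
  have -> : - n.+1%:Z = -1 + - n%:Z by lia.
  by rewrite !zP IH.
Qed.

Lemma ziter_preimage_translates i (C : set X) : translates T C (ziter i @^-1` C).
Proof.
case: i => n; first by right; exists n.
left; exists n.+1 => //; apply/seteqP; split=> [_ [x Cx <-]|x Cx].
  by rewrite /preimage /= -[T _]/(ziter n.+1 x) -[g _]/(ziter (Negz n) _) -ziterD NegzE addNr.
exists (ziter (Negz n) x) => //.
by rewrite -[LHS]/(ziter n.+1 _) -ziterD NegzE subrr.
Qed.

Lemma translates_ziter (C V : set X) :
  translates T C V -> exists i, V = ziter i @^-1` C.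
Proof.
case=> -[n _ <-]; last by exists n.
exists (- n%:Z); apply/seteqP; split=> [_ [x Cx <-]|x Cx].
  by rewrite /preimage /= -[iter n T x]/(ziter n x) -ziterD addNr.
exists (ziter (- n%:Z) x) => //.
by rewrite -[LHS]/(ziter n _) -ziterD subrr.
Qed.

Lemma ziter_measurable (B : set (set X)) i E : borel_automorphism B T ->
  B E -> B (ziter i @^-1` E).
Proof.
move=> [_ BT BTi] BE; case: i => n.
  elim: n E BE => // n IH E BE.
  by have /= := IH _ (BT _ BE).
have Bg F : B F -> B (g @^-1` F).
  move=> /BTi; suff -> : T @` F = g @^-1` F by [].
  apply/seteqP; split=> [_ [x Fx <-]|x Fx]; first by rewrite /preimage /= Tg.
  by exists (g x).
rewrite /ziter; elim: n.+1 E BE => // m IH E BE.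
by have /= := IH _ (Bg _ BE).
Qed.

End two_sided_iteration.

(** Forward images become preimages under negative powers, so all translates take one form. *)
Lemma automorphism_flow (X : Type) (B : set (set X)) (T : X -> X) :
  borel_automorphism B T ->
  exists z : int -> X -> X,
    [/\ forall (n : nat) x, z n x = iter n T x,
        forall i j x, z i (z j x) = z (i + j) x,
        forall i E, B E -> B (z i @^-1` E) &
        forall C V, translates T C V <-> exists i, V = z i @^-1` C].
Proof.
move=> hT; have [[g Tg gT] _ _] := hT; exists (ziter T g); split=> // [i j x|i E|C V].
- by rewrite ziterD.
- exact: ziter_measurable.
- split=> [|[i ->]]; first exact: translates_ziter.
  exact: ziter_preimage_translates.
Qed.

(** * Construction of the generator *)

Lemma sign_setP (X : Type) (b : bool) (S : set X) x :
  (if b then S else ~` S) x <-> b = `[< S x >].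
Proof. by case: b; case: asboolP => h; split. Qed.

Theorem theorem6p3 (R : realType) (X : Type) (B : set (set X)) (T : X -> X)
    (hB : standard_borel R B) (hT : borel_automorphism B T)
    (A : set X) (hA : B A) :
  [/\ B (div_set R T A),
      invariant_set T (div_set R T A) &
      has_set_generator B T (div_set R T A) 4].
Proof.
have sB := standard_borel_sigma_algebra hB.
have [E [BE Egen]] := standard_borel_countably_generated hB.
have [a [ba a_inj]] := distinct_addresses.
have [z [zn zD zB ztr]] := automorphism_flow hT.
pose nm x : name := fun i => `[< A (z i x) >].
have nm_shift i x : nm (z i x) = shift i (nm x).
  by apply/funext => j; rewrite /nm /shift zD addrC.
set Y := div_set R T A.
have YE x : Y x <-> diverges (nm x).
  rewrite /Y /div_set /=.
  have -> : arithmetic_mean (fun i => \1_A (iter i T x) : R) =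
      fun n => n.+1%:R^-1 * (visits (nm x) n.+1)%:R.
    apply/funext => n; rewrite /arithmetic_mean /series /= big_mkord /visits natr_sum.
    by congr (_ * _); apply: eq_bigr => i _; rewrite indicE -zn.
  by split=> [/mean_not_cvg|/diverges_not_cvg].
clearbody Y.
have Yz i x : Y (z i x) <-> Y x by rewrite !YE nm_shift diverges_shift.
have pullB P : borel_pred P -> B [set x | P (nm x)].
  move=> bP; rewrite -[X in B X]setIT; apply: (sigma_trace_pullback sB) => // i.
  rewrite setIT (_ : [set x | _] = z i @^-1` A); first exact: zB.
  by apply/seteqP; split=> x /asboolP.
have BY : B Y.
  by rewrite (_ : Y = [set x | diverges (nm x)]); [exact/pullB/borel_diverges|
    apply/seteqP; split=> x /YE].
split; first exact: BY.
  by apply/seteqP; split=> x; rewrite /preimage /= -[T x](zn 1%N) => /Yz.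
pose loc n x := z (a (nm x) n) x.
have z0 x : z 0 x = x := zn 0%N x.
have zsub i j x y : z i x = z j y -> y = z (i - j) x.
  by move=> /(congr1 (z (- j))); rewrite !zD addNr z0 (addrC (- j)).
have loc_inj m n x y : Y x -> loc m x = loc n y -> x = y /\ m = n.
  (* Equal addresses put [y] on the orbit of [x], so both names are shifts of [nm x] and [a_inj]
     applies. *)
  move=> /YE dx e; have yE := zsub _ _ _ _ e.
  have [|i0 mn] := @a_inj (nm x) 0 (a (nm x) m - a (nm y) n) m n dx.
    by rewrite -(nm_shift (_ - _)) -yE shift0 add0r subrK.
  by rewrite yE -i0 z0.
pose C := [set y | exists x n, [/\ Y x, E n x & loc n x = y]].
have CE n x : Y x -> C (loc n x) <-> E n x.
  move=> Yx; split=> [[y [m [Yy Emy /(loc_inj _ _ _ _ Yy)[<- <-]]]] //|Ex].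
  by exists x, n.
have BI F G : B F -> B G -> B (F `&` G).
  by have := @sigma_traceI _ _ _ sB F G; rewrite !setIT.
have BN F : B F -> B (~` F).
  by have := @sigma_traceC _ _ _ sB F; rewrite !setIT.
have BC : B C.
  (* Once the value [j] of the address is fixed, moving points to their addresses is a single power
     of [T]. *)
  have -> : C = \bigcup_n \bigcup_j
      z (- j) @^-1` ([set x | a (nm x) n = j] `&` (E n `&` Y)).
    apply/seteqP; split=> [y [x [n [Yx Ex <-]]]|y [n _ [j _ [aj [Ex Yx]]]]].
      exists n => //; exists (a (nm x) n) => //.
      by rewrite /preimage /= /loc zD addNr z0.
    exists (z (- j) y), n; split=> //.
    by rewrite /loc aj zD subrr z0.
  apply: (sigma_bigcup_countType sB) => n; apply: (sigma_bigcup_countType sB) => j.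
  apply: zB; apply: (BI); last exact: BI.
  exact: (pullB (fun w => a w n = j) (ba n j)).
(* The low bit of [i] records membership in [A], the high bit membership in [C]. *)
pose cells (i : 'I_4) := ((if odd i then A else ~` A) `&`
  (if (1 < i)%N then C else ~` C)) `&` Y.
have cellsP i x : cells i x <-> [/\ odd i = `[< A x >], (1 < i)%N = `[< C x >] & Y x].
  by split=> [[[/sign_setP ? /sign_setP ?] ?]|[? ? ?]] //; split=> //; split; apply/sign_setP.
have Bcells i : B (cells i).
  by apply: (BI) => //; apply: (BI); case: ifP => _ //; exact: BN.
have cells_cover x : Y x -> exists i, cells i x.
  move=> Yx; exists (inord (`[< A x >] + `[< C x >].*2)%N); apply/cellsP.
  by rewrite inordK; case: `[< A x >]; case: `[< C x >].
exists cells; split=> //.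
- move=> i j _ _ [x [/cellsP[oi hi _] /cellsP[oj hj _]]]; apply: val_inj.
  move: (etrans oi (esym oj)) (etrans hi (esym hj)) => {oi oj hi hj}.
  by case: i j => [[|[|[|[|i]]]] //= _] [[|[|[|[|j]]]] //= _].
- by apply/seteqP; split=> [x [i _ []] //|x /cells_cover[i ci]]; exists i.
set S := <<s Y, _ >>.
have sS : sigma_algebra Y S by exact: smallest_sigma_algebra.
have Scells i j : S (z j @^-1` cells i).
  by apply: sub_sigma_algebra; exists i => //; apply/ztr; exists j.
(* Applied to [A] and [C], whose traces on [Y] are unions of cells. *)
have Sunion (b : 'I_4 -> bool) F j : (forall i x, cells i x -> F x <-> b i) ->
    S (z j @^-1` F `&` Y).
  move=> Fb.
  have -> : z j @^-1` F `&` Y =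
      \bigcup_i (if b i then z j @^-1` cells i else set0).
    apply/seteqP; split=> [x [Fx Yx]|x [i _]].
      have [i ci] := cells_cover _ ((Yz j x).2 Yx).
      by exists i => //; rewrite ((Fb _ _ ci).1 Fx).
    case: ifP => // bi ci; split; first exact/(Fb _ _ ci).
    by apply/(Yz j); have [_] := (cellsP _ _).1 ci.
  apply: (sigma_bigcup_countType sS) => i; case: ifP => _ //; by case: sS.
have SA j : S (z j @^-1` A `&` Y).
  by apply: (Sunion (fun i => odd i)) => i x /cellsP[-> _ _]; split=> /asboolP.
have SC j : S (z j @^-1` C `&` Y).
  by apply: (Sunion (fun i => 1 < i)%N) => i x /cellsP[_ -> _]; split=> /asboolP.
apply/seteqP; split.
  apply: smallest_sub; first exact: sigma_algebra_strace.
  move=> V [i _ /ztr[j ->]].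
  exists (z j @^-1` cells i); first exact: zB.
  apply/seteqP; split=> [x []//|x ci]; split=> //.
  by apply/(Yz j); have [_] := (cellsP _ _).1 ci.
move=> _ [F BF <-]; apply: Egen => // n.
(* Where the address has displacement [j], membership in [E n] is read from [C] at time [j]. This
   region lies in [S] because the address is a Borel function of the [A]-name. *)
have -> : E n `&` Y =
    (\bigcup_j ([set x | a (nm x) n = j] `&` z j @^-1` C)) `&` Y.
  apply/seteqP; split=> [x [Ex Yx]|x [[j _ [aj Cx]] Yx]]; split=> //.
    exists (a (nm x) n) => //; split=> //; exact/(CE n x Yx).
  by apply/(CE n x Yx); rewrite /loc aj.
apply: (sigma_trace_bigcup sS) => j; apply: (sigma_traceI sS) => //.
apply: (sigma_trace_pullback sS (nu := nm) (P := fun w => a w n = j)) => [i|];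
  last exact: ba.
rewrite (_ : [set x | _] = z i @^-1` A); first exact: SA.
by apply/seteqP; split=> x /asboolP.
Qed.
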